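(* Let $(\gamma_1,\rho_1)\in(0,1)^2$, and for $n\ge1$ set $\gamma_n=\gamma_1/\sqrt n$ and $\rho_n=\rho_1/\sqrt n$. Let $(X_n)_{n\ge0}$ be the two-armed penalized Narendra-Shapiro algorithm with success probabilities $(p_1,p_2)$, i.e. for all $n\ge 0$ $$X_{n+1}=X_n+\gamma_{n+1}\left[\mathbf 1_{\{I_{n+1}=1\}}-X_n\right]A_{n+1}^{I_{n+1}}-\gamma_{n+1}\rho_{n+1}\left[X_n\mathbf 1_{\{I_{n+1}=1\}}-(1-X_n)\mathbf 1_{\{I_{n+1}=2\}}\right]\left(1-A_{n+1}^{I_{n+1}}\right),$$ and let $\bar R_n$ be its pseudo-regret. Then for every $\delta\in(0,1)$ there exists a constant $C_\delta>0$ such that $$\forall n\in\mathbb N,\qquad \sup_{(p_1,p_2)\in[0,1]^2,\ p_2\le p_1\wedge(1-\delta)}\bar R_n\le C_\delta\sqrt n .$$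
   Context: There are two arms $1,2$ with success probabilities $p_1,p_2$. The rewards $(A_n^i)_{n\ge1}$, $i\in\{1,2\}$, are two independent sequences of i.i.d. Bernoulli random variables, $A_n^i\sim\mathcal B(p_i)$. $I_n\in\{1,2\}$ is the arm played at time $n\ge1$. $X_n\in[0,1]$ is the probability of playing arm $1$ at time $n+1$: the process starts from a fixed deterministic $X_0\in(0,1)$ and, conditionally on the history $\mathcal F_n=\sigma((I_k,A_k^{I_k}),1\le k\le n)$, $\mathbb P(I_{n+1}=1\mid\mathcal F_n)=X_n$, $\mathbb P(I_{n+1}=2\mid\mathcal F_n)=1-X_n$, while $(A_{n+1}^1,A_{n+1}^2)$ is independent of $\mathcal F_n$ and $I_{n+1}$. The pseudo-regret is $$\bar R_n=\max_{j\in\{1,2\}}\mathbb E\sum_{k=1}^n\left[A_k^j-A_k^{I_k}\right].$$ The constant $C_\delta$ may depend on $\gamma_1,\rho_1$ (which are fixed) but not on $n,p_1,p_2$. $x\wedge y=\min(x,y)$. *)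

(* Defs.v *)
From HB Require Import structures.
From mathcomp Require Export all_boot all_order all_algebra.
From mathcomp Require Export all_classical all_reals all_analysis.
Export Order.TTheory GRing.Theory Num.Theory.
Export numFieldNormedType.Exports.

Set Implicit Arguments.
Unset Strict Implicit.
Unset Printing Implicit Defensive.

Global Open Scope classical_set_scope.
Global Open Scope ring_scope.

Section sigma_algebras.
Context {d} {T : measurableType d} {R : realType}.
Implicit Types F G : set (set T).

Definition sigma_of {d'} {T' : measurableType d'} {K : Type} (D : set K)
    (Y : K -> T -> T') : set (set T) :=
  <<s \bigcup_(k in D) g_sigma_algebra_preimage (Y k) >>.

Definition sigma_join F G : set (set T) := <<s F `|` G >>.

Definition independent (P : probability T R) F G :=
  forall A B, F A -> G B -> P (A `&` B) = (P A * P B)%E.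

Definition mutually_independent {d'} {T' : measurableType d'} {K : choiceType}
    (P : probability T R) (D : set K) (Y : K -> T -> T') :=
  forall (s : seq K) (E : K -> set T),
    uniq s -> (forall k, k \in s -> D k) ->
    (forall k, k \in s -> g_sigma_algebra_preimage (Y k) (E k)) ->
    P (\bigcap_(k in [set` s]) E k) = (\prod_(k <- s) P (E k))%E.

(* Z is a version of the conditional probability P(E | F) *)
Definition is_cond_prob (P : probability T R) F (E : set T) (Z : T -> R) :=
  g_sigma_algebra_preimage Z `<=` F /\
  forall B, F B -> (\int[P]_(w in B) (Z w)%:E)%E = P (E `&` B).

End sigma_algebras.

(* Arms are encoded in bool: arm 1 is true and arm 2 is false.  The rewards
   A_n^i are boolean random variables, true standing for the value 1.
   Times start at 1: the variables A i 0 and I 0 play no role. *)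
Notation arm := bool (only parsing).
Notation arm1 := true (only parsing).
Notation arm2 := false (only parsing).

Section penalized_narendra_shapiro.
Context {d} {T : measurableType d} {R : realType}.
Variables (A : arm -> nat -> T -> bool) (I : nat -> T -> arm).

Definition played_reward (n : nat) (w : T) : bool := A (I n w) n w.

Definition history (n : nat) : set (set T) :=
  sigma_of [set k | (1 <= k <= n)%N] (fun k w => (I k w, played_reward k w)).

Fixpoint penalized_NS (gamma rho : nat -> R) (x0 : R) (n : nat) (w : T) : R :=
  if n is m.+1 then
    let x := penalized_NS gamma rho x0 m w in
    let a : R := (played_reward n w)%:R in
    let one1 : R := (I n w == arm1)%:R in
    let one2 : R := (I n w == arm2)%:R in
    x + gamma n * (one1 - x) * a
      - gamma n * rho n * (x * one1 - (1 - x) * one2) * (1 - a)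
  else x0.

Definition pseudo_regret (P : probability T R) (n : nat) : \bar R :=
  \big[maxe/-oo%E]_(j : arm)
    'E_P[fun w => (\sum_(1 <= k < n.+1)
                     ((A j k w)%:R - (played_reward k w)%:R))%R]%E.

End penalized_narendra_shapiro.

Record is_NS_bandit {d} {T : measurableType d} {R : realType}
    (P : probability T R) (gamma rho : nat -> R) (x0 p1 p2 : R)
    (A : arm -> nat -> {RV P >-> bool}) (I : nat -> {RV P >-> arm}) : Prop := {
  reward_law : forall (i : arm) (n : nat), (1 <= n)%N ->
    distribution P (A i n) = bernoulli_prob (if i == arm1 then p1 else p2)
      :> (set bool -> \bar R) ;
  reward_indep : forall i : arm,
    mutually_independent P [set n | (1 <= n)%N] (fun n => A i n : T -> bool) ;
  reward_arms_indep : independent P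
    (sigma_of [set n | (1 <= n)%N] (fun n => A arm1 n : T -> bool))
    (sigma_of [set n | (1 <= n)%N] (fun n => A arm2 n : T -> bool)) ;
  play_arm1 : forall n : nat,
    is_cond_prob P (history A I n) (I n.+1 @^-1` [set arm1])
      (penalized_NS A I gamma rho x0 n) ;
  play_arm2 : forall n : nat,
    is_cond_prob P (history A I n) (I n.+1 @^-1` [set arm2])
      (fun w => 1 - penalized_NS A I gamma rho x0 n w) ;
  reward_history_indep : forall n : nat, independent P
    (sigma_of [set: arm] (fun i => A i n.+1 : T -> bool))
    (sigma_join (history A I n)
      (g_sigma_algebra_preimage (I n.+1 : T -> arm))) }.

(* Main.v *)
Require Import Defs.
From mathcomp Require Import ring lra.

(* Write X for the state, Y = 1 - X and pi = p1 - p2.  The pseudo-regret is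
   the sum of pi E[Y_k].  At time n+1, put h = K gamma_(n+1) / pi and use
   1 / (X + h) as a Lyapunov function.  The drift pi X Y of the reward steps
   decreases it; near X = 0, where that drift degenerates, the penalty
   gamma rho (1 - p2) >= gamma rho delta takes over, and the offset h, which
   has the order of the jumps divided by pi, makes the second order terms
   harmless for K large.  This gives a decrease by c gamma pi Y / (X + h) up to
   an error O(gamma^2 + gamma rho) = O(1/n).  After multiplication by sqrt n,
   the sum telescopes to sum pi E[Y_k] = O(sqrt n), from the time when
   pi sqrt n exceeds a constant; before that time the bound is trivial.
   Everything is uniform in X_0, because h > 0 bounds the Lyapunov function. *)

Set Implicit Arguments.
Unset Strict Implicit.
Unset Printing Implicit Defensive.

(** * One step of the algorithm and the drift of 1 / (X + h) *)

Section one_step.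
Context {R : realType}.
Implicit Types (gamma rho p x : R) (phi psi : R -> R).

(** The transition operator of the chain: the mean of [phi] at the next state, given the current
    state [x]. The four terms are arm 1 winning, arm 1 losing, arm 2 winning and arm 2 losing. *)
Definition NS_mean gamma rho (p1 p2 : R) phi x : R :=
  x * (p1 * phi (x + gamma * (1 - x)) + (1 - p1) * phi (x - gamma * rho * x)) +
  (1 - x) * (p2 * phi (x - gamma * x) +
             (1 - p2) * phi (x + gamma * rho * (1 - x))).

Lemma NS_meanD gamma rho (p1 p2 : R) phi psi x :
  NS_mean gamma rho p1 p2 (fun x => phi x + psi x) x =
  NS_mean gamma rho p1 p2 phi x + NS_mean gamma rho p1 p2 psi x.
Proof. by rewrite /NS_mean; ring. Qed.

Lemma NS_meanZ gamma rho (p1 p2 : R) a phi x :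
  NS_mean gamma rho p1 p2 (fun x => a * phi x) x =
  a * NS_mean gamma rho p1 p2 phi x.
Proof. by rewrite /NS_mean; ring. Qed.

Lemma NS_mean_cst gamma rho (p1 p2 : R) a x :
  NS_mean gamma rho p1 p2 (cst a) x = a.
Proof. by rewrite /NS_mean /=; ring. Qed.

(** All four weights are nonnegative and all four successors of a point of (0,1) stay in (0,1), so a
    comparison on the open interval suffices. *)
Lemma NS_mean_le gamma rho (p1 p2 : R) phi psi :
    0 < gamma < 1 -> 0 < rho < 1 -> 0 <= p1 <= 1 -> 0 <= p2 <= 1 ->
    (forall x, 0 < x < 1 -> phi x <= psi x) ->
  forall x, 0 < x < 1 ->
  NS_mean gamma rho p1 p2 phi x <= NS_mean gamma rho p1 p2 psi x.
Proof.
move=> /andP[g0 g1] /andP[r0 r1] /andP[p10 p11] /andP[p20 p21] le_phi x.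
move=> /andP[x0 x1].
have gr0 : 0 < gamma * rho by rewrite mulr_gt0.
have gr1 : gamma * rho < 1 by rewrite mulr_ilt1 ?ltW.
have [[? ?] [? ?]] : (0 < gamma * (1 - x) /\ gamma * (1 - x) < 1 - x) /\
    (0 < gamma * x /\ gamma * x < x) by split; nra.
have [[? ?] [? ?]] : (0 < gamma * rho * (1 - x) /\
    gamma * rho * (1 - x) < 1 - x) /\
    (0 < gamma * rho * x /\ gamma * rho * x < x) by split; nra.
rewrite /NS_mean lerD// ler_wpM2l ?lerD ?ler_wpM2l//; try lra;
  by apply: le_phi; apply/andP; split; lra.
Qed.

(** Second order expansion for an upward jump; the gap between the two sides is exactly d^3 / (z^3
    (z + d)). *)
Lemma invD_le (z d : R) : 0 < z -> 0 <= d ->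
  (z + d)^-1 <= z^-1 - d * z^-1 ^+ 2 + d ^+ 2 * z^-1 ^+ 3.
Proof.
move=> z0 d0; have zd0 : 0 < z + d by exact: ltr_wpDr.
rewrite -subr_ge0.
have -> : z^-1 - d * z^-1 ^+ 2 + d ^+ 2 * z^-1 ^+ 3 - (z + d)^-1 =
    d ^+ 3 * z^-1 ^+ 3 * (z + d)^-1 by field; rewrite !lt0r_neq0.
by rewrite !mulr_ge0 ?exprn_ge0 ?invr_ge0// ltW.
Qed.

(** Second order expansion for a downward jump. The exact remainder is d^2 / (z^2 (z - d)), and z -
    d is at least (1 - g) z. *)
Lemma invB_le (g z d : R) : 0 < z -> g < 1 -> 0 <= d <= g * z ->
  (z - d)^-1 <= z^-1 + d * z^-1 ^+ 2 + d ^+ 2 * (1 - g)^-1 * z^-1 ^+ 3.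
Proof.
move=> z0 g1 /andP[d0 dz].
have zg0 : 0 < (1 - g) * z by rewrite mulr_gt0 ?subr_gt0.
have zd : (1 - g) * z <= z - d by lra.
have zd0 : 0 < z - d := lt_le_trans zg0 zd.
have -> : (z - d)^-1 = z^-1 + d * z^-1 ^+ 2 + d ^+ 2 * z^-1 ^+ 2 * (z - d)^-1.
  by field; rewrite !lt0r_neq0.
rewrite lerD2l.
have -> : d ^+ 2 * (1 - g)^-1 * z^-1 ^+ 3 =
    d ^+ 2 * z^-1 ^+ 2 * ((1 - g) * z)^-1.
  by field; rewrite !lt0r_neq0 ?subr_gt0.
apply: ler_wpM2l; first by rewrite mulr_ge0 ?sqr_ge0.
by rewrite lef_pV2.
Qed.

(** Each of the four jumps is expanded to second order. In the bracket, (p1 - p2) x is the reward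
    drift and rho delta y the penalty drift of arm 2, since 1 - p2 >= delta; the two subtracted
    terms are second order effects. The error gamma rho + gamma^2 l pays for the penalty of arm
    1. *)
Lemma NS_mean_inv_taylor (g gamma rho p1 p2 delta h x : R) :
    g < 1 -> 0 < gamma <= g -> 0 < rho < 1 ->
    0 <= p1 <= 1 -> 0 <= p2 <= 1 - delta -> 0 < delta < 1 ->
    0 < h -> 0 < x < 1 ->
  let y := 1 - x in let u := (x + h)^-1 in let l := (1 - g)^-1 in
  NS_mean gamma rho p1 p2 (fun x => (x + h)^-1) x <=
    u - gamma * y * u ^+ 2 *
      ((p1 - p2) * x + rho * delta * y - x * ((1 + l) * (gamma * u))
       - rho * (rho * (gamma * u)))
    + gamma * rho + gamma ^+ 2 * l.
Proof.
move=> g1 /andP[ga0 gag] /andP[r0 r1] /andP[p10 p11] /andP[p20 p2d].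
move=> /andP[d0 d1] h0 /andP[x0 x1].
cbv zeta; set l := (1 - g)^-1; set u := (x + h)^-1; rewrite /NS_mean.
set y := 1 - x.
have y0 : 0 < y by rewrite subr_gt0.
have z0 : 0 < x + h by exact: addr_gt0.
have u0 : 0 < u by rewrite invr_gt0.
have l0 : 0 < l by rewrite invr_gt0 subr_gt0.
have gr0 : 0 < gamma * rho by rewrite mulr_gt0.
have t1 : (x + gamma * y + h)^-1 <=
    u - gamma * y * u ^+ 2 + (gamma * y) ^+ 2 * u ^+ 3.
  rewrite addrAC; apply: invD_le => //; apply: mulr_ge0; exact: ltW.
have t2 : (x - gamma * rho * x + h)^-1 <=
    u + gamma * rho * x * u ^+ 2 + (gamma * rho * x) ^+ 2 * l * u ^+ 3.
  rewrite addrAC; apply: invB_le => //.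
  rewrite mulr_ge0 ?(ltW gr0) ?(ltW x0)//=.
  have : gamma * rho <= g by apply: le_trans gag; rewrite ler_piMr ?ltW.
  clear -ga0 gag x0 h0; nra.
have t3 : (x - gamma * x + h)^-1 <=
    u + gamma * x * u ^+ 2 + (gamma * x) ^+ 2 * l * u ^+ 3.
  rewrite addrAC; apply: invB_le => //.
  rewrite mulr_ge0 ?(ltW ga0) ?(ltW x0)//=.
  clear -ga0 gag x0 h0; nra.
have t4 : (x + gamma * rho * y + h)^-1 <=
    u - gamma * rho * y * u ^+ 2 + (gamma * rho * y) ^+ 2 * u ^+ 3.
  rewrite addrAC; apply: invD_le => //; apply: mulr_ge0; exact: ltW.
have e1 : 0 <= p1 by [].
have e2 : 0 <= 1 - p1 by rewrite subr_ge0.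
have e3 : 0 <= 1 - p2 - delta by clear -p2d; lra.
have e4 : 0 <= 1 - p2 by clear -p2d d0; lra.
apply: (@le_trans _ _ (
    x * (p1 * (u - gamma * y * u ^+ 2 + (gamma * y) ^+ 2 * u ^+ 3) +
      (1 - p1) * (u + gamma * rho * x * u ^+ 2 +
        (gamma * rho * x) ^+ 2 * l * u ^+ 3)) +
    y * (p2 * (u + gamma * x * u ^+ 2 + (gamma * x) ^+ 2 * l * u ^+ 3) +
      (1 - p2) * (u - gamma * rho * y * u ^+ 2 +
        (gamma * rho * y) ^+ 2 * u ^+ 3)))).
  by apply: lerD; (apply: ler_wpM2l; first exact: ltW);
    apply: lerD; apply: ler_wpM2l.
rewrite -subr_ge0.
set D := (X in 0 <= X).
(* The slack splits into six nonnegative terms: the part of 1 - p2 beyond delta, the first and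
   second order penalty of arm 1, then the second order terms of a win of arm 1, a win of arm 2 and
   a loss of arm 2. Their signs follow from x u <= 1 and y <= 1. *)
have -> : D = (1 - p2 - delta) * (gamma * rho * (y * u) ^+ 2)
    + gamma * rho * (1 - (1 - p1) * (x * u) ^+ 2)
    + gamma ^+ 2 * l * (1 - (1 - p1) * (rho ^+ 2 * (x * u) ^+ 3))
    + gamma ^+ 2 * u ^+ 3 * x * y * (1 - p1 * y)
    + gamma ^+ 2 * u ^+ 3 * x * y * l * (1 - p2 * x)
    + gamma ^+ 2 * rho ^+ 2 * u ^+ 3 * y * (1 - (1 - p2) * y ^+ 2).
  by rewrite /D /y; ring.
have xu0 : 0 <= x * u by apply: mulr_ge0; exact: ltW.
have xu1 : x * u <= 1.
  by rewrite /u ler_pdivrMr// mul1r ler_wpDr// ltW.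
have y1 : y <= 1 by rewrite /y gerBl ltW.
have c1 (a b : R) : 0 <= a -> a <= 1 -> 0 <= b -> b <= 1 -> 0 <= 1 - a * b.
  by move=> *; rewrite subr_ge0 mulr_ile1.
have q1 : 1 - p1 <= 1 by rewrite gerBl.
have q2 : 1 - p2 <= 1 by rewrite gerBl.
have p21 : p2 <= 1 by rewrite -subr_ge0.
repeat apply: addr_ge0; apply: mulr_ge0 => //.
- by apply: mulr_ge0; [exact: ltW | exact: sqr_ge0].
- exact: ltW.
- by apply: c1 => //; [exact: sqr_ge0 | exact: exprn_ile1].
- by apply: mulr_ge0; [exact: sqr_ge0 | exact: ltW].
- have x3 := exprn_ge0 3 xu0; apply: c1 => //.
    by apply: mulr_ge0 => //; exact: sqr_ge0.
  apply: mulr_ile1 => //; [exact: sqr_ge0 | | exact: exprn_ile1].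
  by apply: exprn_ile1; exact: ltW.
- by apply: ltW; rewrite !mulr_gt0// exprn_gt0.
- by apply: c1 => //; exact: ltW.
- by apply: ltW; rewrite !mulr_gt0// exprn_gt0.
- by apply: c1 => //; exact: ltW.
- by apply: ltW; rewrite !mulr_gt0// exprn_gt0.
- by apply: c1 => //; [exact: sqr_ge0 | apply: exprn_ile1 => //; exact: ltW].
Qed.

(** As h u <= 1, the choice of h gives gamma u <= (p1 - p2) / K. The two lower bounds on K then make
    the second order terms at most half of the reward drift plus a quarter of rho delta, and the two
    upper bounds on c keep the bracket above c (p1 - p2) (x + h) up to an error that matters only
    for small y. *)
Lemma NS_mean_inv_le (g gamma rho p1 p2 delta K c h x : R) :
    g < 1 -> 0 < gamma <= g -> 0 < rho < 1 ->
    0 <= p1 <= 1 -> 0 <= p2 <= 1 - delta -> 0 < delta < 1 ->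
    0 < p1 - p2 ->
    2 * (1 + (1 - g)^-1) <= K -> 4 <= K * delta ->
    0 < c <= 2^-1 -> 4 * c * K * gamma <= rho * delta ->
    h = K * gamma / (p1 - p2) -> 0 < x < 1 ->
  NS_mean gamma rho p1 p2 (fun x => (x + h)^-1) x <=
    (x + h)^-1 - c * gamma * (p1 - p2) * (1 - x) * (x + h)^-1
    + gamma ^+ 2 * (1 - g)^-1 + 2 * gamma * rho.
Proof.
move=> g1 ga rh p1_01 p2_01 dl pi0 KL Kd /andP[c0 c1] cK hE x_01.
have /andP[ga0 gag] := ga; have /andP[r0 r1] := rh; have /andP[d0 d1] := dl.
have /andP[x0 x1] := x_01.
have K0 : 0 < K by clear -Kd d0 d1; nra.
have h0 : 0 < h by rewrite hE !mulr_gt0// invr_gt0.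
have := NS_mean_inv_taylor g1 ga rh p1_01 p2_01 dl h0 x_01.
have pi1 : p1 - p2 <= 1.
  have [/andP[_ p11] /andP[p20 _]] := (p1_01, p2_01).
  by rewrite lerBlDr (le_trans p11)// lerDl.
have pih : (p1 - p2) * h = K * gamma by rewrite hE; field; rewrite lt0r_neq0.
set pi := p1 - p2 in pi0 pi1 pih *; move: pi => pi in pi0 pi1 pih *.
clear hE p1_01 p2_01.
set M := NS_mean _ _ _ _ _ _; move: M => M /=.
set l := (1 - g)^-1 in KL *.
have l0 : 0 < l by rewrite invr_gt0 subr_gt0.
have zu : (x + h) * (x + h)^-1 = 1 by rewrite mulfV// lt0r_neq0// addr_gt0.
have : 0 < (x + h)^-1 by rewrite invr_gt0 addr_gt0.
set u := (x + h)^-1 in zu * => u0 le_b; apply: le_trans le_b _.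
have : 0 < 1 - x by rewrite subr_gt0.
set y := 1 - x => y0.
move: l u zu u0 l0 KL => l u zu u0 l0 KL.
have gr0 : 0 < gamma * rho by rewrite mulr_gt0.
have gu0 : 0 < gamma * u by rewrite mulr_gt0.
have hu1 : h * u <= 1 by rewrite -zu mulrDl lerDr mulr_ge0// ltW.
have Kgu : K * gamma * u <= pi by rewrite -pih -mulrA ler_piMr// ltW.
have b1 : (1 + l) * (gamma * u) <= pi / 2 by clear -Kgu gu0 KL; nra.
have b2 : rho * (gamma * u) <= delta / 4.
  by clear -Kgu gu0 Kd r0 r1 pi1 d0; nra.
set b := pi * x + _ - _ - _.
have bz : rho * delta * (y - 2^-1) <= b - c * (pi * (x + h)).
  have -> : pi * (x + h) = pi * x + K * gamma by rewrite -pih; ring.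
  have m1 : x * ((1 + l) * (gamma * u)) <= x * (pi / 2).
    by rewrite ler_wpM2l// ltW.
  have m2 : rho * (rho * (gamma * u)) <= rho * (delta / 4).
    by rewrite ler_wpM2l// ltW.
  have m3 : 0 <= (2^-1 - c) * (pi * x).
    by apply: mulr_ge0; [rewrite subr_ge0 | apply: mulr_ge0; exact: ltW].
  by rewrite /b; clear -m1 m2 m3 cK; lra.
have yb : - (gamma * rho) <= gamma * y * u ^+ 2 * (b - c * (pi * (x + h))).
  move: bz; set B := b - _ => bz.
  have rd0 : 0 < rho * delta by rewrite mulr_gt0.
  have yu0 : 0 < y * u ^+ 2 by rewrite mulr_gt0 ?exprn_gt0.
  (* If y >= 1/2 the bracket is nonnegative. Otherwise x > 1/2, so u <= 2 and y u^2 <= 2, while the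
     bracket is at least - rho / 2: the loss is at most gamma rho. *)
  have [y2|y2] := leP 2^-1 y.
    have B0 : 0 <= B by apply: le_trans bz; rewrite mulr_ge0 ?subr_ge0// ltW.
    apply: (@le_trans _ _ 0); first by rewrite oppr_le0 ltW.
    by rewrite mulr_ge0// -mulrA mulr_ge0// ltW.
  have u2 : u <= 2 by clear -zu y2 y0 h0 u0; rewrite /y in y2 y0; nra.
  have yu2 : y * u ^+ 2 <= 2 by clear -u2 u0 y2 y0; rewrite expr2; nra.
  have rd1 : rho * delta <= rho by rewrite ler_piMr// ltW.
  have -> : gamma * y * u ^+ 2 * B = gamma * (y * u ^+ 2 * B) by ring.
  rewrite -mulrN; apply: ler_wpM2l; first exact: ltW.
  have BR : - (rho / 2) <= B.
    apply: le_trans bz; move: (mulr_ge0 (ltW rd0) (ltW y0)) => m.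
    by clear -m rd1; lra.
  clear bz; move: (y * u ^+ 2) yu0 yu2 B BR => w w0 w2 B BR.
  by clear -w0 w2 BR r0; nra.
have -> : c * gamma * pi * y * u = gamma * y * u ^+ 2 * (c * (pi * (x + h))).
  by rewrite -[LHS]mulr1 -zu; ring.
by clear -yb; lra.
Qed.
End one_step.

(** * Expectations along the chain, by iterating the transition operator *)

Section expectation.
Context {R : realType}.
Variables (gamma rho : nat -> R) (x0 p1 p2 : R).

(** This is E[phi(X_n)] computed without any probability space: the operator of the last step is
    applied first, and the result is evaluated at [x0] in the end. *)
Fixpoint NS_expect (n : nat) (phi : R -> R) : R :=
  if n is m.+1 then
    NS_expect m (fun x => NS_mean (gamma n) (rho n) p1 p2 phi x)
  else phi x0.

Lemma eq_NS_expect n phi psi : phi =1 psi -> NS_expect n phi = NS_expect n psi.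
Proof. by move=> /funext ->. Qed.

Lemma NS_expectD n phi psi :
  NS_expect n (fun x => phi x + psi x) = NS_expect n phi + NS_expect n psi.
Proof.
elim: n => [//|n IH] in phi psi *; rewrite /= -IH; apply: eq_NS_expect => x.
exact: NS_meanD.
Qed.

Lemma NS_expectZ n a phi :
  NS_expect n (fun x => a * phi x) = a * NS_expect n phi.
Proof.
elim: n => [//|n IH] in phi *; rewrite /= -IH; apply: eq_NS_expect => x.
exact: NS_meanZ.
Qed.

Lemma NS_expect_cst n a : NS_expect n (cst a) = a.
Proof.
elim: n => [//|n IH]; rewrite /= -[RHS]IH; apply: eq_NS_expect => x.
exact: NS_mean_cst.
Qed.

Hypothesis gamma01 : forall n, 0 < gamma n.+1 < 1.
Hypothesis rho01 : forall n, 0 < rho n.+1 < 1.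
Hypothesis x0_01 : 0 < x0 < 1.
Hypothesis p1_01 : 0 <= p1 <= 1.
Hypothesis p2_01 : 0 <= p2 <= 1.

Lemma NS_expect_le n phi psi : (forall x, 0 < x < 1 -> phi x <= psi x) ->
  NS_expect n phi <= NS_expect n psi.
Proof.
elim: n => [|n IH] in phi psi * => le_phi; first exact: le_phi.
by apply: IH => x; apply: NS_mean_le.
Qed.

Lemma NS_expect_itv n a b phi : (forall x, 0 < x < 1 -> a <= phi x <= b) ->
  a <= NS_expect n phi <= b.
Proof.
move=> phi_ab; rewrite -{1}(NS_expect_cst n a) -(NS_expect_cst n b).
by apply/andP; split; apply: NS_expect_le => x /phi_ab /andP[].
Qed.

End expectation.

(** * The weighted Lyapunov function and the telescoping sum *)

Section lyapunov.
Context {R : realType}.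
Variables (g r delta K c : R).
Hypothesis g_01 : 0 < g < 1.
Hypothesis r_01 : 0 < r < 1.
Hypothesis delta_01 : 0 < delta < 1.
Hypothesis KL : 2 * (1 + (1 - g)^-1) <= K.
Hypothesis Kdelta : 4 <= K * delta.
Hypothesis c_gt0 : 0 < c.
Hypothesis c_le : c <= 2^-1.
Hypothesis cKg : 4 * c * K * g <= r * delta.

Let sqrtS (n : nat) : R := Num.sqrt n.+1%:R.
Let gamma (n : nat) : R := g / Num.sqrt n%:R.
Let rho (n : nat) : R := r / Num.sqrt n%:R.

Lemma sqrtS_ge1 n : 1 <= sqrtS n.
Proof. by rewrite -[1]sqrtr1 ler_sqrt// ler1n. Qed.

Lemma div_sqrtS_01 (a : R) n : 0 < a < 1 -> 0 < a / sqrtS n < 1.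
Proof.
move=> /andP[a0 a1]; have s1 := sqrtS_ge1 n.
have s0 : 0 < sqrtS n := lt_le_trans ltr01 s1.
by rewrite divr_gt0// ltr_pdivrMr// mul1r (lt_le_trans a1).
Qed.

Lemma K_gt0 : 0 < K.
Proof.
have /andP[d0 _] := delta_01.
by rewrite -(pmulr_lgt0 _ d0) (lt_le_trans _ Kdelta).
Qed.

Section fixed_bandit.
Variables (x0 p1 p2 : R).
Hypothesis x0_01 : 0 < x0 < 1.
Hypothesis p1_01 : 0 <= p1 <= 1.
Hypothesis p2_01 : 0 <= p2 <= 1 - delta.
Hypothesis pi_gt0 : 0 < p1 - p2.

Let E := NS_expect gamma rho x0 p1 p2.
Let q := K * g / (p1 - p2).

(* This is [sqrt (n+1) / (x + h)] with [h = K gamma_(n+1) / (p1 - p2)]. *)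
Let W (n : nat) (x : R) : R := n.+1%:R / (sqrtS n * x + q).

(** The one-step error is e / (n+1) with e = g^2 / (1 - g) + 2 g r; the weight is at most twice sqrt
    (n+1), whence 2 e. The summand 1 pays for part of the growth of the weight. *)
Let E0 := 2 * (g ^+ 2 * (1 - g)^-1 + 2 * g * r) + 1.

(** The growth of the weight costs u / s with s = sqrt (n+1) and u = 1 / (x + h). As x u <= 1, this
    is at most 1 / s plus y u / s; for s large the latter takes at most half of the drift c g (p1 -
    p2) y u. The other half suffices because h <= 1 gives u >= 1/2. *)
Lemma NS_mean_W_le n x : 2 <= c * g * (p1 - p2) * sqrtS n -> 0 < x < 1 ->
  NS_mean (gamma n.+1) (rho n.+1) p1 p2 (W n.+1) x <=
  W n x - c * g / 4 * ((p1 - p2) * (1 - x)) + E0 / sqrtS n.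
Proof.
move=> s_large x_01; have /andP[x_gt0 x_lt1] := x_01.
have g01 := div_sqrtS_01 n g_01; have r01 := div_sqrtS_01 n r_01.
have /andP[g0 g1] := g_01; have /andP[r0 r1] := r_01.
have /andP[d0 d1] := delta_01.
set s := sqrtS n in s_large g01 r01 *.
have s1 : 1 <= s by exact: sqrtS_ge1.
have s0 : 0 < s by exact: lt_le_trans ltr01 s1.
have s2 : s ^+ 2 = n.+1%:R by rewrite sqr_sqrtr.
have ss' : s <= sqrtS n.+1 by rewrite ler_sqrt// ler_nat.
have K0 := K_gt0.
have q0 : 0 < q by rewrite !mulr_gt0// invr_gt0.
have p2_1 : 0 <= p2 <= 1.
  by move: p2_01 => /andP[-> /le_trans ->]//; rewrite gerBl ltW.
pose h := q / s.
have h0 : 0 < h by rewrite divr_gt0.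
(* Here h is frozen at its value at time n, and (n+2) / s = s + 1 / s, so that the one-step bound
   applies with a fixed offset. *)
have W_le y : 0 < y < 1 -> W n.+1 y <= (s + s^-1) * (y + h)^-1.
  move=> /andP[y0 _]; rewrite /W -natr1 -s2.
  have -> : (s + s^-1) * (y + h)^-1 = (s ^+ 2 + 1) / (s * y + q).
    rewrite /h; field; rewrite !lt0r_neq0//.
    by rewrite addr_gt0// mulr_gt0.
  rewrite ler_wpM2l ?addr_ge0 ?sqr_ge0// lef_pV2 ?posrE.
  - by rewrite lerD2r ler_wpM2r// ltW.
  - by rewrite addr_gt0// mulr_gt0// (lt_le_trans s0).
  - by rewrite addr_gt0// mulr_gt0.
apply: le_trans (NS_mean_le g01 r01 p1_01 p2_1 W_le x_01) _.
rewrite NS_meanZ.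
have gag : 0 < g / s <= g.
  by rewrite divr_gt0//= ler_pdivrMr// ler_peMr// ltW.
have cK : 4 * c * K * (g / s) <= r / s * delta.
  rewrite [leLHS]mulrA [r / s * _]mulrAC.
  by apply: ler_wpM2r => //; rewrite invr_ge0 ltW.
have hE : h = K * (g / s) / (p1 - p2).
  by rewrite /h /q; field; rewrite !lt0r_neq0.
have c_itv : 0 < c <= 2^-1 by rewrite c_gt0.
have := NS_mean_inv_le g1 gag r01 p1_01 p2_01 delta_01 pi_gt0 KL Kdelta c_itv
  cK hE x_01.
set M := NS_mean _ _ _ _ _ _; move: M => M.
have z0 : 0 < x + h by rewrite addr_gt0.
set u := (x + h)^-1 => M_le.
have u0 : 0 < u by rewrite invr_gt0.
have -> : W n x = s * u.
  by rewrite /W -/s -s2 /u /h; field; rewrite !lt0r_neq0// addr_gt0// mulr_gt0.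
set l := (1 - g)^-1 in M_le *.
have l0 : 0 < l by rewrite invr_gt0 subr_gt0.
have xu1 : x * u <= 1 by rewrite /u ler_pdivrMr// mul1r lerDl ltW.
have pi0 := pi_gt0; set pi := p1 - p2 in pi0 s_large M_le hE *.
have h1 : h <= 1.
  have piS : c * g * pi * s * h = g * (c * K * g).
    by rewrite hE; field; rewrite !lt0r_neq0.
  have cKg1 : 4 * (c * K * g) <= 1.
    by rewrite !mulrA (le_trans cKg)// mulr_ile1// ltW.
  have cKg0 : 0 < c * K * g by rewrite !mulr_gt0.
  have : 2 * h <= g * (c * K * g) by rewrite -piS ler_wpM2r// ltW.
  have : g * (c * K * g) <= c * K * g by rewrite ler_piMl// ltW.
  by lra.
have u2 : 2^-1 <= u.
  by rewrite lef_pV2 ?posrE//; apply: lerD; rewrite ?(ltW x_lt1).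
have sV : s^-1 <= c * g * pi / 2.
  rewrite -[s^-1]mul1r ler_pdivrMr//.
  by rewrite mulrAC ler_pdivlMr// mul1r.
have sV0 : 0 < s^-1 by rewrite invr_gt0.
have sV1 : s^-1 <= 1 by rewrite invf_le1.
have ssV : s * s^-1 = 1 by rewrite mulfV// lt0r_neq0.
rewrite /E0.
set y := 1 - x in M_le *.
have y0 : 0 < y by rewrite subr_gt0.
have yu0 : 0 < y * u by rewrite mulr_gt0.
have l2 : 0 < g ^+ 2 * l + 2 * g * r by rewrite addr_gt0 ?mulr_gt0// exprn_gt0.
set e := g ^+ 2 * l + 2 * g * r in l2 *.
have {}M_le : M <= u - c * g * pi * (y * u) * s^-1 + e * s^-1 ^+ 2.
  by rewrite /e; lra.
apply: (@le_trans _ _ ((s + s^-1) *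
    (u - c * g * pi * (y * u) * s^-1 + e * s^-1 ^+ 2))).
  by rewrite ler_wpM2l// addr_ge0// ltW.
have k1 : 0 <= c * g * pi * (y * u) * s^-1 ^+ 2 by rewrite !mulr_ge0// ltW.
have k2 : e * s^-1 ^+ 3 <= e * s^-1.
  rewrite ler_wpM2l ?(ltW l2)// exprS ler_piMr ?(ltW sV0)//.
  by rewrite exprn_ile1// ltW.
have k3 : u * s^-1 <= (y * u + 1) * (s^-1).
  rewrite ler_wpM2r ?(ltW sV0)// /y mulrBl mul1r.
  by rewrite -addrA [- _ + _]addrC addrA -lerBDr opprK lerD2l.
have k4 : y * u * s^-1 <= y * u * (c * g * pi / 2) by rewrite ler_wpM2l// ltW.
have k5 : y * (c * g * pi) / 4 <= y * u * (c * g * pi) / 2.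
  have -> : y * (c * g * pi) / 4 = y * (c * g * pi) / 2 * 2^-1 by field.
  have -> : y * u * (c * g * pi) / 2 = y * (c * g * pi) / 2 * u by field.
  by rewrite ler_wpM2l// divr_ge0// !mulr_ge0// ltW.
have -> : (s + s^-1) * (u - c * g * pi * (y * u) * s^-1 + e * s^-1 ^+ 2) =
  s * u - c * g * pi * (y * u) * (s * s^-1) - c * g * pi * (y * u) * s^-1 ^+ 2
  + e * s^-1 * (s * s^-1) + u * s^-1 + e * s^-1 ^+ 3 by ring.
rewrite ssV !mulr1.
have -> : c * g / 4 * (pi * y) = y * (c * g * pi) / 4 by ring.
by lra.
Qed.

(* As long as [(p1 - p2) sqrt n] is bounded, both the regret and [W] are
   trivially [O(sqrt n)]; afterwards the drift of [W] takes over. *)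
Lemma NS_expect_regret_le n (T := 2 / (c * g))
    (C := 2 * T * (c * g / 4 + (K * g)^-1) + 3 * E0) :
  c * g / 4 * (\sum_(k < n) (p1 - p2) * E k (fun x => 1 - x)) + E n (W n) <=
  C * sqrtS n.
Proof.
have /andP[g0 g1] := g_01; have /andP[r0 r1] := r_01.
have /andP[d0 d1] := delta_01.
have K0 := K_gt0.
have q0 : 0 < q by rewrite !mulr_gt0// invr_gt0.
have p2_1 : 0 <= p2 <= 1.
  by move: p2_01 => /andP[-> /le_trans ->]//; rewrite gerBl ltW.
have gamma01 k : 0 < gamma k.+1 < 1 by exact: div_sqrtS_01.
have rho01 k : 0 < rho k.+1 < 1 by exact: div_sqrtS_01.
have T0 : 0 < T by rewrite divr_gt0// mulr_gt0.
have E0_gt0 : 0 < E0.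
  rewrite addr_gt0// mulr_gt0// addr_gt0// !mulr_gt0 ?exprn_gt0//.
  by rewrite invr_gt0 subr_gt0.
(* Here Y <= 1 and W <= (m+1) / q, and 1 / q carries a factor p1 - p2; the assumption absorbs p1 -
   p2 together with one of the two factors sqrt (m+1). *)
have small m : (p1 - p2) * sqrtS m <= 2 * T ->
    c * g / 4 * (\sum_(k < m) (p1 - p2) * E k (fun x => 1 - x)) + E m (W m)
    <= C * sqrtS m.
  move=> m_small.
  have s0 : 0 < sqrtS m by exact: lt_le_trans (sqrtS_ge1 m).
  have s2 : sqrtS m ^+ 2 = m.+1%:R by rewrite sqr_sqrtr.
  have S_le : \sum_(k < m) (p1 - p2) * E k (fun x => 1 - x) <= 2 * T * sqrtS m.
    apply: (@le_trans _ _ (\sum_(k < m) (p1 - p2))).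
      apply: ler_sum => k _; rewrite ler_piMr ?(ltW pi_gt0)//.
      have /andP[] // : 0 <= E k (fun x => 1 - x) <= 1.
      by apply: NS_expect_itv => // x /andP[? ?]; rewrite subr_ge0 gerBl !ltW.
    rewrite sumr_const card_ord -[leLHS]mulr_natr.
    apply: (@le_trans _ _ ((p1 - p2) * sqrtS m ^+ 2)).
      by rewrite s2; apply: ler_wpM2l; [exact: ltW | rewrite ler_nat].
    by rewrite expr2 mulrA ler_wpM2r// ltW.
  have W_le : E m (W m) <= 2 * T * (K * g)^-1 * sqrtS m.
    have /andP[_] : 0 <= E m (W m) <= m.+1%:R / q.
      apply: NS_expect_itv => // x /andP[xp _]; rewrite /W.
      have z0 : 0 < sqrtS m * x by rewrite mulr_gt0.
      have w0 : 0 < sqrtS m * x + q by rewrite addr_gt0.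
      apply/andP; split; first by rewrite divr_ge0// ltW.
      by apply: ler_wpM2l => //; rewrite lef_pV2 ?posrE// lerDr ltW.
    move=> /le_trans; apply; rewrite -s2.
    have -> : sqrtS m ^+ 2 / q = (p1 - p2) * sqrtS m * ((K * g)^-1 * sqrtS m).
      by rewrite /q; field; rewrite !lt0r_neq0.
    rewrite -[leRHS]mulrA; apply: ler_wpM2r => //.
    by rewrite mulr_ge0 ?invr_ge0// ltW// mulr_gt0.
  have cg0 : 0 < c * g / 4 by rewrite divr_gt0 ?mulr_gt0.
  apply: (@le_trans _ _ (c * g / 4 * (2 * T * sqrtS m) +
      2 * T * (K * g)^-1 * sqrtS m)).
    by rewrite lerD// ler_wpM2l// ltW.
  rewrite -subr_ge0 (_ : _ - _ = 3 * E0 * sqrtS m); last by rewrite /C; ring.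
  by rewrite !mulr_ge0// ltW.
elim: n => [|n IH].
  apply: small; rewrite /sqrtS sqrtr1 mulr1.
  have [/andP[_ p11] /andP[p20 _]] := (p1_01, p2_01).
  apply: (@le_trans _ _ 1); first by rewrite lerBlDr (le_trans p11)// lerDl.
  rewrite /T mulrA ler_pdivlMr ?mulr_gt0// mul1r.
  have : c * g <= c by rewrite ler_piMr// ltW.
  move=> /le_trans; apply; apply: (le_trans c_le); lra.
have [|large] := leP ((p1 - p2) * sqrtS n.+1) (2 * T); first exact: small.
have s1 := sqrtS_ge1 n.
have s0 : 0 < sqrtS n by exact: lt_le_trans s1.
have s2 : sqrtS n ^+ 2 = n.+1%:R by rewrite sqr_sqrtr.
have s'2 : sqrtS n.+1 ^+ 2 = sqrtS n ^+ 2 + 1 by rewrite sqr_sqrtr// s2 natr1.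
have s'0 : 0 < sqrtS n.+1 by exact: lt_le_trans (sqrtS_ge1 n.+1).
set s := sqrtS n in IH s0 s1 s'2 s2 *.
set s' := sqrtS n.+1 in large s'2 s'0 *.
(* This moves the threshold from s' to s: the factor 2 in 2 T is lost, leaving T <= (p1 - p2) s,
   which is the largeness condition of the drift bound. *)
have s'le : s' <= 2 * s by nra.
have s_large : 2 <= c * g * (p1 - p2) * s.
  have : T <= (p1 - p2) * s.
    have : (p1 - p2) * s' <= (p1 - p2) * (2 * s) by rewrite ler_wpM2l// ltW.
    by lra.
  by rewrite ler_pdivrMr ?mulr_gt0// => T_le; lra.
have step : E n.+1 (W n.+1) <=
    E n (W n) - c * g / 4 * ((p1 - p2) * E n (fun x => 1 - x)) + E0 / s.
  rewrite -!NS_expectZ.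
  have -> : E n (W n) - E n (fun x => c * g / 4 * ((p1 - p2) * (1 - x))) +
      E0 / s =
      E n (fun x => W n x + -1 * (c * g / 4 * ((p1 - p2) * (1 - x))) + E0 / s).
    rewrite /E; under [RHS]eq_NS_expect do rewrite -addrA.
    rewrite !NS_expectD (NS_expectZ _ _ _ _ _ _ (-1)) NS_expect_cst.
    by rewrite mulN1r addrA.
  rewrite /E [leLHS]/=; apply: NS_expect_le => // x x_01.
  by rewrite mulN1r; apply: NS_mean_W_le.
move: step; set EW := E n.+1 (W n.+1) => step; rewrite big_ord_recr/=.
(* Indeed s' - s = 1 / (s' + s) and s' <= 2 s. Thus the summand 3 E0 of C pays for the error E0 /
   s. *)
have sV : 3^-1 / s <= s' - s.
  rewrite ler_pdivrMr//; nra.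
have C3 : 3 * E0 <= C.
  rewrite lerDr ltW//; apply: mulr_gt0; first exact: mulr_gt0.
  by rewrite addr_gt0 ?divr_gt0 ?invr_gt0// mulr_gt0.
have : E0 / s <= C * (s' - s).
  apply: (@le_trans _ _ (3 * E0 * (3^-1 / s))).
    by lra.
  have ss : 0 <= 3^-1 / s by rewrite divr_ge0 ?invr_ge0// ltW.
  by apply: ler_pM => //; rewrite mulr_ge0// ltW.
move: IH step; move: (\sum_(i < n) _) => S.
move: (E n (W n)) (E n _) EW (C) (E0 / s) => a b a' C' e.
by lra.
Qed.

End fixed_bandit.
End lyapunov.

(** * Choice of the constants, uniform in the starting point and in the bandit *)

Lemma NS_expect_regret_sum_le (R : realType) (g r delta : R) :
    0 < g < 1 -> 0 < r < 1 -> 0 < delta < 1 ->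
  exists C : R, 0 < C /\ forall x0 p1 p2 : R, 0 < x0 < 1 -> 0 <= p1 <= 1 ->
    0 <= p2 <= 1 - delta -> p2 <= p1 -> forall n,
  \sum_(k < n) (p1 - p2) *
    NS_expect (fun k => g / Num.sqrt k%:R) (fun k => r / Num.sqrt k%:R)
      x0 p1 p2 k (fun x => 1 - x) <= C * Num.sqrt n%:R.
Proof.
move=> g_01 r_01 d_01.
have [/andP[g0 g1] [/andP[r0 r1] /andP[d0 d1]]] := (g_01, (r_01, d_01)).
have l0 : 0 < (1 - g)^-1 by rewrite invr_gt0 subr_gt0.
(* K is the sum of its two required lower bounds, and c below is chosen so that 4 c K = r delta.
   Both depend on g, r and delta only. *)
pose K := 2 * (1 + (1 - g)^-1) + 4 / delta.
have K0 : 0 < K by rewrite addr_gt0 ?divr_gt0// mulr_gt0// addr_gt0.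
have KL : 2 * (1 + (1 - g)^-1) <= K by rewrite lerDl divr_ge0// ltW.
have Kd : 4 <= K * delta.
  by rewrite -ler_pdivrMr// lerDr mulr_ge0// addr_ge0// ltW.
pose c := r * delta / (4 * K).
have rd0 : 0 < r * delta by rewrite mulr_gt0.
have rd1 : r * delta <= 1 by rewrite mulr_ile1// ltW.
have c0 : 0 < c by rewrite divr_gt0// mulr_gt0.
have c_le : c <= 2^-1.
  have K4 : 4 <= K by apply: le_trans Kd _; rewrite ler_piMr// ltW.
  by rewrite ler_pdivrMr ?mulr_gt0//; lra.
have cKg : 4 * c * K * g <= r * delta.
  have -> : 4 * c * K * g = r * delta * g.
    by rewrite /c; field; rewrite lt0r_neq0.
  by rewrite ler_piMr// ltW.
have cg0 : 0 < c * g / 4 by rewrite divr_gt0// mulr_gt0.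
set a := c * g / 4 in cg0.
pose C := 2 * (2 / (c * g)) * (c * g / 4 + (K * g)^-1) +
  3 * (2 * (g ^+ 2 * (1 - g)^-1 + 2 * g * r) + 1).
have C0 : 0 < C.
  have T0 : 0 < 2 / (c * g) by rewrite divr_gt0// mulr_gt0.
  have Kg0 : 0 < (K * g)^-1 by rewrite invr_gt0 mulr_gt0.
  apply: addr_gt0; first by rewrite mulr_gt0 ?addr_gt0// mulr_gt0.
  by rewrite mulr_gt0// addr_gt0// mulr_gt0// addr_gt0// !mulr_gt0// exprn_gt0.
exists (2 * C / a); split; first by rewrite divr_gt0// mulr_gt0.
move=> x0 p1 p2 x0_01 p1_01 p2_01 p21 n.
case: n => [|n]; first by rewrite big_ord0 sqrtr0 mulr0.
(* Equal arms are treated apart, because the offset h divides by p1 - p2; their regret is zero. *)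
move: p21; rewrite le_eqVlt => /predU1P[<-|p21].
  rewrite big1 => [|k _]; last by rewrite subrr mul0r.
  by rewrite !mulr_ge0 ?sqrtr_ge0 ?invr_ge0// ltW.
have pi0 : 0 < p1 - p2 by rewrite subr_gt0.
have := NS_expect_regret_le g_01 r_01 d_01 KL Kd c0 c_le cKg x0_01 p1_01 p2_01
  pi0 n.+1.
rewrite -/a -/C.
set S := \sum_(_ < _) _; set w := NS_expect _ _ _ _ _ _ _ => Sw.
have w0 : 0 <= w.
  have q0 : 0 < K * g / (p1 - p2) by rewrite !mulr_gt0// invr_gt0.
  have p2_1 : 0 <= p2 <= 1.
    by move: p2_01 => /andP[-> /le_trans ->]//; rewrite gerBl ltW.
  rewrite -(NS_expect_cst (fun k => g / Num.sqrt k%:R)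
    (fun k => r / Num.sqrt k%:R) x0 p1 p2 n.+1 0).
  apply: NS_expect_le => //= [k|k|x /andP[x_gt0 _]].
  - exact: div_sqrtS_01.
  - exact: div_sqrtS_01.
  - by rewrite divr_ge0// addr_ge0 ?(ltW q0)// mulr_ge0 ?sqrtr_ge0// ltW.
(* The Lyapunov bound at time n+1 involves sqrt (n+2); this explains the factor 2 in the witness. *)
have s2 : Num.sqrt n.+2%:R <= 2 * Num.sqrt n.+1%:R :> R.
  rewrite (_ : 2 = Num.sqrt (2 ^+ 2)); last by rewrite sqrtr_sqr ger0_norm.
  rewrite -sqrtrM ?sqr_ge0// ler_sqrt ?mulr_gt0 ?exprn_gt0//.
  have : 1 <= n.+1%:R :> R by rewrite ler1n.
  by rewrite -[n.+2%:R]natr1; move: (n.+1%:R : R) => a1 a1_ge1; lra.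
have -> : 2 * C / a * Num.sqrt n.+1%:R = C * (2 * Num.sqrt n.+1%:R) / a.
  by ring.
rewrite ler_pdivlMr// mulrC.
apply: le_trans (ler_wpM2l (ltW C0) s2).
by apply: le_trans Sw; rewrite lerDl.
Qed.

(** * Finite enumeration of the histories and their weights *)

Definition outcomes : seq (bool * bool) :=
  [:: (true, true); (true, false); (false, true); (false, false)].

Fixpoint play_paths (n : nat) : seq (seq (bool * bool)) :=
  if n is m.+1 then [seq o :: s | s <- play_paths m, o <- outcomes]
  else [:: [::]].

Lemma size_paths n s : s \in play_paths n -> size s = n.
Proof.
elim: n s => [|n IH] s; first by rewrite inE => /eqP ->.
by move=> /allpairsP[[s' o] /= [/IH <- _ ->]].
Qed.

Section path_weights.
Context {R : realType}.
Variables (gamma rho : nat -> R) (x0 p1 p2 : R).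

(* The lists record the pairs (arm, reward), most recent first. *)
Fixpoint path_state (s : seq (bool * bool)) : R :=
  if s is (i, a) :: s' then
    let x := path_state s' in let n := (size s').+1 in
    x + gamma n * ((i == arm1)%:R - x) * a%:R
      - gamma n * rho n * (x * (i == arm1)%:R - (1 - x) * (i == arm2)%:R)
        * (1 - a%:R)
  else x0.

Definition play_prob (x : R) (i : bool) : R := if i then x else 1 - x.

Definition reward_prob (i a : bool) : R :=
  let p := if i == arm1 then p1 else p2 in if a then p else 1 - p.

(** The factors follow the order of conditioning: the past, then the arm given the past, then a
    reward independent of both. *)
Fixpoint path_prob (s : seq (bool * bool)) : R :=
  if s is (i, a) :: s' then
    reward_prob i a * (play_prob (path_state s') i * path_prob s')
  else 1.

(** Summing over the head of the list, which is the latest outcome, applies the transition operator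
    of the last step, in the same order as [NS_expect]. *)
Lemma sum_paths_NS_expect n (phi : R -> R) :
  \sum_(s <- play_paths n) path_prob s * phi (path_state s) =
  NS_expect gamma rho x0 p1 p2 n phi.
Proof.
elim: n phi => [|n IH] phi; first by rewrite big_seq1 /= mul1r.
rewrite [LHS]big_allpairs_dep/= -IH big_seq [RHS]big_seq.
apply: eq_bigr => s /size_paths sn.
rewrite !big_cons big_nil/= sn /NS_mean /reward_prob /play_prob/=.
set x := path_state s.
rewrite !(mulr0, mulr1, subr0, addr0, sub0r, subrr).
have -> : x + gamma n.+1 * - x = x - gamma n.+1 * x by rewrite mulrN.
have -> : x - gamma n.+1 * rho n.+1 * - (1 - x) =
  x + gamma n.+1 * rho n.+1 * (1 - x) by rewrite mulrN opprK.
by ring.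
Qed.

End path_weights.

(** * From the probabilistic model to the finite sums *)

Section bandit.
Context {d : measure_display} {T : measurableType d} {R : realType}.
Variables (P : probability T R) (gamma rho : nat -> R) (x0 p1 p2 : R).
Variables (A : arm -> nat -> {RV P >-> bool}) (I : nat -> {RV P >-> arm}).
Hypothesis NS : is_NS_bandit gamma rho x0 p1 p2 A I.
Hypothesis p1_01 : 0 <= p1 <= 1.
Hypothesis p2_01 : 0 <= p2 <= 1.

Let outcome (n : nat) (w : T) : bool * bool := (I n w, played_reward A I n w).

Fixpoint play_path (n : nat) (w : T) : seq (bool * bool) :=
  if n is m.+1 then outcome n w :: play_path m w else [::].

Lemma size_path n w : size (play_path n w) = n.
Proof. by elim: n => //= n ->. Qed.

(** The state depends on the path alone, so it is constant on each path event. *)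
Lemma penalized_NS_path n w :
  penalized_NS A I gamma rho x0 n w = path_state gamma rho x0 (play_path n w).
Proof. by elim: n => //= n ->; rewrite size_path. Qed.

Let path_event (s : seq (bool * bool)) : set T :=
  [set w | play_path (size s) w = s].

Lemma history_setI n B C :
  history A I n B -> history A I n C -> history A I n (B `&` C).
Proof.
move=> hB hC.
exact: (@measurableI _ (g_sigma_algebraType
  (\bigcup_(k in [set k | (1 <= k <= n)%N])
    g_sigma_algebra_preimage (outcome k))) _ _ hB hC).
Qed.

Lemma history_mono n : history A I n `<=` history A I n.+1.
Proof.
apply: sub_sigma_algebra2 => B [k /= /andP[k1 kn]] hB; exists k => //=.
by rewrite k1 leqW.
Qed.

Lemma history_outcome n o :
  (0 < n)%N -> history A I n (outcome n @^-1` [set o]).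
Proof.
move=> n0; apply: sub_sigma_algebra; exists n => /=; first by rewrite n0 leqnn.
exists [set o]; last by rewrite setTI.
have -> : [set o] = [set o.1] `*` [set o.2].
  by case: o => o1 o2; apply/seteqP; split => [_ -> //|[i a] /= [-> ->]].
exact: measurableX.
Qed.

Lemma path_eventS o s :
  path_event (o :: s) = outcome (size s).+1 @^-1` [set o] `&` path_event s.
Proof.
by apply/seteqP; split => w; rewrite /path_event/= => -[-> ->].
Qed.

(** Path events are thus legitimate test sets for the conditional probabilities of the arms. *)
Lemma history_path_event s : history A I (size s) (path_event s).
Proof.
elim: s => [|o s IH].
  have -> : path_event [::] = setT by apply/seteqP; split.
  exact: (@measurableT _ (g_sigma_algebraType
    (\bigcup_(k in [set k | (1 <= k <= 0)%N])
      g_sigma_algebra_preimage (outcome k)))).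
rewrite path_eventS; apply: history_setI; first exact: history_outcome.
exact: history_mono.
Qed.

Lemma measurable_played_reward n a :
  measurable (played_reward A I n @^-1` [set a]).
Proof.
have -> : played_reward A I n @^-1` [set a] =
    (I n @^-1` [set true] `&` A true n @^-1` [set a]) `|`
    (I n @^-1` [set false] `&` A false n @^-1` [set a]).
  apply/seteqP; split => w /=; rewrite /played_reward.
    by case: (I n w) => <-; [left|right].
  by move=> [] [-> ->].
by apply: measurableU; apply: measurableI; exact: measurable_funPTI.
Qed.

Lemma measurable_outcome n o : measurable (outcome n @^-1` [set o]).
Proof.
have -> : outcome n @^-1` [set o] =
    I n @^-1` [set o.1] `&` played_reward A I n @^-1` [set o.2].
  apply/seteqP; split => w /=; rewrite /outcome; first by move=> <-.
  by case: o => i a /= [-> ->].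
apply: measurableI; last exact: measurable_played_reward.
exact: measurable_funPTI.
Qed.

Lemma measurable_path_event s : measurable (path_event s).
Proof.
elim: s => [|o s IH].
  by have -> : path_event [::] = setT by apply/seteqP; split.
by rewrite path_eventS; apply: measurableI => //; exact: measurable_outcome.
Qed.

Lemma probability_reward i n a :
  P (A i n.+1 @^-1` [set a]) = (reward_prob p1 p2 i a)%:E.
Proof.
have -> : P (A i n.+1 @^-1` [set a]) = distribution P (A i n.+1) [set a] by [].
rewrite (reward_law NS)// /reward_prob; set p := if _ then _ else _.
have p01 : 0 <= p <= 1 by rewrite /p; case: ifP.
have mem1 b : (b \in [set a]) = (b == a) by apply/idP/eqP; rewrite inE.
rewrite bernoulli_probE// !diracE !mem1.
by case: a {mem1}; rewrite /= ?mule1 ?mule0 ?adde0 ?add0e.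
Qed.

(** The latest reward is split off by independence from the past and the arm; the arm is then
    handled by integrating its conditional probability over the path event of the past. *)
Lemma probability_path s :
  P (path_event s) = (path_prob gamma rho x0 p1 p2 s)%:E.
Proof.
elim: s => [|[i a] s IH] /=.
  have -> : path_event [::] = setT by apply/seteqP; split.
  exact: probability_setT.
(* Once the arm is known to be i, the played reward is that of the fixed sequence [A i], to which
   independence applies. *)
have -> : path_event ((i, a) :: s) = A i (size s).+1 @^-1` [set a] `&`
    (I (size s).+1 @^-1` [set i] `&` path_event s).
  rewrite path_eventS setIA; congr (_ `&` _).
  apply/seteqP; split => w /=; rewrite /outcome /played_reward.
    by move=> [<- <-].
  by move=> [<- <-].
rewrite (reward_history_indep NS (n := size s)); first last.
- have hj : forall B, (history A I (size s) `|`
      g_sigma_algebra_preimage (I (size s).+1 : T -> arm)) B ->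
      sigma_join (history A I (size s))
        (g_sigma_algebra_preimage (I (size s).+1 : T -> arm)) B.
    exact: sub_sigma_algebra.
  apply: (@measurableI _ (g_sigma_algebraType (history A I (size s) `|`
      g_sigma_algebra_preimage (I (size s).+1 : T -> arm)))); apply: hj.
    by right; exists [set i]; rewrite ?setTI.
  by left; exact: history_path_event.
- apply: sub_sigma_algebra; exists i => //.
  by exists [set a]; rewrite ?setTI.
rewrite probability_reward EFinM; congr (_ * _)%E.
have state_cst (phi : R -> R) :
    (\int[P]_(w in path_event s)
      (phi (penalized_NS A I gamma rho x0 (size s) w))%:E =
    (phi (path_state gamma rho x0 s) * path_prob gamma rho x0 p1 p2 s)%:E)%E.
  rewrite EFinM -IH -integral_cst; last exact: measurable_path_event.
  by apply: eq_integral => w /set_mem; rewrite penalized_NS_path /= => ->.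
case: i.
  rewrite -((play_arm1 NS (size s)).2 _ (@history_path_event s)).
  exact: (state_cst id).
rewrite -((play_arm2 NS (size s)).2 _ (@history_path_event s)).
exact: (state_cst (fun x => 1 - x)).
Qed.

Lemma measure_outcomes B n : measurable B ->
  P B = (\sum_(o <- outcomes) P (outcome n @^-1` [set o] `&` B))%E.
Proof.
move=> mB.
have mO o := measurable_outcome n o.
have split2 (f : T -> bool) C : measurable C ->
    measurable (f @^-1` [set true]) -> measurable (f @^-1` [set false]) ->
    P C = (P (f @^-1` [set true] `&` C) + P (f @^-1` [set false] `&` C))%E.
  move=> mC m1 m2; rewrite -measureU//; first last.
  - by apply/seteqP; split => w //= -[[-> _] []].
  - exact: measurableI.
  - exact: measurableI.
  congr (P _); apply/seteqP; split => w /=; last by case; case.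
  by case: (f w); [left|right].
rewrite /outcomes !big_cons big_nil adde0.
have outE i a : outcome n @^-1` [set (i, a)] `&` B =
    played_reward A I n @^-1` [set a] `&` (I n @^-1` [set i] `&` B).
  apply/seteqP; split => w /=; rewrite /outcome.
    by move=> [[-> ->]].
  by move=> [-> [->]].
have mI i : measurable (I n @^-1` [set i]) by exact: measurable_funPTI.
rewrite !outE (split2 (I n))// addeA.
by congr (_ + _)%E; (apply: (split2 (played_reward A I n));
  [exact: measurableI|exact: measurable_played_reward..]).
Qed.

(** The path events of length n partition the space; each step refines them by the next outcome. *)
Lemma measure_paths n B : measurable B ->
  P B = (\sum_(s <- play_paths n) P (path_event s `&` B))%E.
Proof.
move=> mB; elim: n => [|n ->].
  rewrite big_seq1; congr (P _); apply/seteqP; split => w //=.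
  by case.
rewrite [RHS]big_allpairs_dep/= big_seq [RHS]big_seq.
apply: eq_bigr => s _; rewrite (measure_outcomes (size s).+1).
  by apply: eq_bigr => o _; rewrite path_eventS setIA.
by apply: measurableI => //; exact: measurable_path_event.
Qed.

Lemma probability_played_reward n :
  P (played_reward A I n.+1 @^-1` [set true]) =
  (NS_expect gamma rho x0 p1 p2 n (fun x => x * p1 + (1 - x) * p2))%:E.
Proof.
rewrite (measure_paths n (measurable_played_reward _ _)).
rewrite -sum_paths_NS_expect -sumEFin big_seq [RHS]big_seq.
apply: eq_bigr => s /size_paths sn.
have -> : path_event s `&` played_reward A I n.+1 @^-1` [set true] =
    path_event ((true, true) :: s) `|` path_event ((false, true) :: s).
  rewrite !path_eventS sn -setIUl setIC; congr (_ `&` _).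
  apply/seteqP; split => w /=; rewrite /outcome.
    by move=> ->; case: (I _ w); [left|right].
  by move=> [] [].
transitivity (P (path_event ((true, true) :: s)) +
    P (path_event ((false, true) :: s)))%E; last first.
  rewrite !probability_path -EFinD /= /reward_prob /play_prob/=.
  by congr (_%:E); ring.
apply: measureU; [exact: measurable_path_event..|].
by rewrite !path_eventS; apply/seteqP; split => w //= -[[-> _] []].
Qed.

Lemma indic_bool (f : T -> bool) w : (f w)%:R = \1_(f @^-1` [set true]) w :> R.
Proof.
by rewrite indicE; congr ((nat_of_bool _)%:R); apply/idP/idP; rewrite inE.
Qed.

Lemma integrable_bool (f : T -> bool) : measurable (f @^-1` [set true]) ->
  P.-integrable setT (fun w => (f w)%:R%:E).
Proof.
by move=> mf; under eq_fun do rewrite indic_bool; exact: integrable_indic.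
Qed.

Lemma integral_bool (f : T -> bool) : measurable (f @^-1` [set true]) ->
  (\int[P]_w (f w)%:R%:E = P (f @^-1` [set true]))%E.
Proof.
move=> mf; under eq_integral do rewrite indic_bool.
by rewrite integral_indic// setIT.
Qed.

Lemma expected_regret j n :
  ('E_P[fun w => (\sum_(1 <= k < n.+1)
     ((A j k w)%:R - (played_reward A I k w)%:R))%R] =
   (\sum_(k < n) ((if j then p1 else p2) - NS_expect gamma rho x0 p1 p2 k
      (fun x => x * p1 + (1 - x) * p2)))%:E)%E.
Proof.
have mA k : measurable (A j k @^-1` [set true]) by exact: measurable_funPTI.
have mR k := measurable_played_reward k true.
rewrite unlock; under eq_integral do rewrite big_add1/= big_mkord -sumEFin.
rewrite integral_sum//; last first.
  move=> k; under eq_fun do rewrite EFinB.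
  by apply: integrableB => //; exact: integrable_bool.
rewrite -sumEFin; apply: eq_bigr => k _.
under eq_integral do rewrite EFinB.
rewrite integralB//; [|exact: integrable_bool..].
rewrite !integral_bool// probability_reward probability_played_reward EFinB.
by case: (j).
Qed.

Hypothesis p21 : p2 <= p1.

(** The mean reward x p1 + (1 - x) p2 equals p1 - (p1 - p2) (1 - x), so arm 1 gives equality; for
    arm 2 each term is smaller, as p2 <= p1. *)
Lemma pseudo_regret_le n :
  (pseudo_regret A I P n <= (\sum_(k < n) (p1 - p2) *
    NS_expect gamma rho x0 p1 p2 k (fun x => 1 - x))%:E)%E.
Proof.
apply: bigmax_le => [|j _]; first exact: leNye.
rewrite expected_regret lee_fin; apply: ler_sum => k _.
have -> : NS_expect gamma rho x0 p1 p2 k (fun x => x * p1 + (1 - x) * p2) =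
    p1 - (p1 - p2) * NS_expect gamma rho x0 p1 p2 k (fun x => 1 - x).
  rewrite -mulNr -NS_expectZ -[X in X + _](NS_expect_cst gamma rho x0 p1 p2 k).
  by rewrite -NS_expectD; apply: eq_NS_expect => x /=; ring.
by have := p21; case: j => /=; lra.
Qed.

End bandit.

Theorem theorem3p1 (R : realType) (gamma1 rho1 : R)
    (gamma1_01 : 0 < gamma1 < 1) (rho1_01 : 0 < rho1 < 1)
    (delta : R) (delta_01 : 0 < delta < 1) :
  exists C : R, 0 < C /\
    forall x0 : R, 0 < x0 < 1 ->
    forall n : nat,
      (ereal_sup [set r : \bar R | (exists p1 p2 : R,
         [/\ 0 <= p1 <= 1, 0 <= p2 <= 1, p2 <= Num.min p1 (1 - delta) &
          exists (d : measure_display) (T : measurableType d)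
                 (P : probability T R)
                 (A : arm -> nat -> {RV P >-> bool})
                 (I : nat -> {RV P >-> arm}),
            is_NS_bandit (fun k => gamma1 / Num.sqrt k%:R)
                         (fun k => rho1 / Num.sqrt k%:R) x0 p1 p2 A I /\
            r = pseudo_regret A I P n])%R]
       <= (C * Num.sqrt n%:R)%:E)%E.
Proof.
have [C [C0 regret_le]] := NS_expect_regret_sum_le gamma1_01 rho1_01 delta_01.
exists C; split=> // x0 x0_01 n; apply: ge_ereal_sup => r [p1 [p2 []]].
move=> p1_01 p2_01; rewrite le_min => /andP[p21 p2d].
move=> [d [T [P [A [I [NS ->]]]]]].
apply: le_trans (pseudo_regret_le NS p1_01 p2_01 p21 n) _.
rewrite lee_fin regret_le//.
by rewrite p2d andbT; case/andP: p2_01.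
Qed.
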